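(* Let $G$ be a finitely generated group, let $\phi:G_1\to G$ be a surjective contracting virtual endomorphism of $G$, and let $S$ be a finite generating set of $G$ with $1\in S=S^{-1}$. Let $F:G\to G$, $F(g)=\phi(r_ig)$, be the map defined by a coset transversal $\{r_1=1,r_2,\dots,r_d\}$ (see context). Then there exist positive integers $m$ and $n$ such that $F^{\circ n}$ defines a simplicial map $F^{\circ n}:\Gamma(G,S^m)\to\Gamma(G,S^m)$ and this map is homotopic, through continuous maps $\Phi:\Gamma(G,S^m)\to\Gamma(G,S^m)$ satisfying $$\Phi(\xi\cdot g)=\Phi(\xi)\cdot\phi^{\circ n}(g)\quad\text{for all }\xi\in\Gamma(G,S^m),\ g\in\operatorname{Dom}\phi^{\circ n},$$ to a contracting map.
   Context: A virtual endomorphism of $G$ is a homomorphism $\phi:G_1\to G$ from a finite index subgroup $G_1=\operatorname{Dom}\phi\le G$; $\phi^{\circ n}$ is the $n$th iterate, defined on the finite index subgroup $\operatorname{Dom}\phi^{\circ n}$ of elements for which the iterate makes sense. Let $d=[G:G_1]$ and let $r_1=1,r_2,\dots,r_d\in G$ be such that for every $g\in G$ there is exactly one $i$ with $r_ig\in G_1$. Define $F:G\to G$ by $F(g)=\phi(r_ig)$, where $r_ig\in G_1$. Then $F(gh)=F(g)\phi(h)$ for $h\in G_1$. For $g\in G$ and $i\in\{1,\dots,d\}$ let $j$ be the unique index with $r_jgr_i^{-1}\in G_1$, and put $g|_i=\phi(r_jgr_i^{-1})$; for words put $g|_{i_1i_2\cdots i_k}=(\cdots(g|_{i_1})|_{i_2}\cdots)|_{i_k}$.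 The virtual endomorphism $\phi$ is contracting if the associated self-similar action is contracting, i.e., if there is a finite set $\mathcal N\subset G$ such that for every $g\in G$ there is $k_0$ with $g|_v\in\mathcal N$ for all words $v$ of length at least $k_0$. (This does not depend on the choice of the transversal.) For a finite set $T\subset G$, $\Gamma(G,T)$ is the simplicial complex with vertex set $G$ in which a non-empty subset $A\subset G$ is a simplex iff $A\cdot g^{-1}\subset T$ for all $g\in A$. $G$ acts on $\Gamma(G,T)$ from the right by translations of vertices. $S^m$ is the set of products of $m$ elements of $S$. The geometric realization of $\Gamma(G,S^m)$ carries the length metric in which each simplex is a regular Euclidean simplex with edges of length $1$. A map $\Phi$ of a metric space to itself is contracting if there are $k\ge1$ and $0<\lambda<1$ such that $d(\Phi^{\circ k}(\xi_1),\Phi^{\circ k}(\xi_2))\le\lambda\, d(\xi_1,\xi_2)$ for all $\xi_1,\xi_2$. *)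

(* Defs.v *)
From HB Require Import structures.
From mathcomp Require Import all_boot all_order all_algebra.
From mathcomp Require Import all_classical all_reals all_analysis.
Set Implicit Arguments.
Unset Strict Implicit.
Unset Printing Implicit Defensive.
Import Order.TTheory GRing.Theory Num.Theory.
Import numFieldNormedType.Exports.
Local Open Scope classical_set_scope.
Local Open Scope ring_scope.

(** * Virtual endomorphisms *)

Definition finite_index (G : groupType) (H : groupClosed G) : Prop :=
  finite_set [set [set (g * h)%g | h in [set` H]] | g in [set: G]].

(* As for [{morphism D >-> rT}], the map is total but its values are only
   meaningful on the domain: nothing below depends on them elsewhere. *)
Record virtual_endo (G : groupType) := VirtualEndo {
  vdom : groupClosed G;
  vfun :> G -> G;
  vdom_finite_index : finite_index vdom;
  vfunM : {in vdom &, {morph vfun : g h / (g * h)%g}}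
}.

Section VirtualEndo.
Variables (G : groupType) (phi : virtual_endo G).

Definition vsurjective : Prop := phi @` [set` vdom phi] = [set: G].

(* The [n]-th iterate of [phi] is [iter n phi] restricted to this set. *)
Definition iter_dom (n : nat) : set G :=
  [set g | forall k, (k < n)%N -> iter k phi g \in vdom phi].

Section Transversal.
Variables (d : nat) (r : 'I_d.+1 -> G).

Definition coset_transversal : Prop :=
  r ord0 = 1%g /\ forall g, exists! i, (r i * g)%g \in vdom phi.

Definition coset_idx (g : G) : 'I_d.+1 :=
  xget ord0 [set i | (r i * g)%g \in vdom phi].

Definition transversal_map (g : G) : G := phi (r (coset_idx g) * g)%g.

Definition section_at (g : G) (i : 'I_d.+1) : G :=
  phi (r (coset_idx (g * (r i)^-1)) * g * (r i)^-1)%g.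

Definition section_word (g : G) (v : seq 'I_d.+1) : G := foldl section_at g v.

Definition contracting_endo : Prop :=
  exists2 N : set G, finite_set N &
    forall g, exists k0, forall v, (k0 <= size v)%N -> N (section_word g v).

End Transversal.
End VirtualEndo.

(** * Generating sets *)

Definition generates (G : groupType) (S : set G) : Prop :=
  forall H : groupClosed G, S `<=` [set` H] -> [set` H] = [set: G].

Definition setpow (G : groupType) (S : set G) (m : nat) : set G :=
  [set (\prod_(i < m) s i)%g | s in [set s : 'I_m -> G | forall i, S (s i)]].

(** * Simplicial complexes and their geometric realizations *)

(* A complex is given by its set of simplices. *)
Definition simplicial_map (V W : Type) (K : set (set V)) (L : set (set W))
    (f : V -> W) : Prop :=
  forall A, K A -> L (f @` A).

(* Points are given by their barycentric coordinates. *)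
Record realization (R : realType) (V : choiceType) (K : set (set V)) :=
  Realization {
    bary :> V -> R;
    bary_ge0 : forall v, 0 <= bary v;
    bary_fin : finite_set [set v | bary v != 0];
    bary_sum : \sum_(v \in [set: V]) bary v = 1;
    bary_simplex : K [set v | bary v != 0]
  }.

Section Realization.
Variables (R : realType) (V : choiceType) (K : set (set V)).
Local Notation X := (@realization R V K).

HB.instance Definition _ := gen_eqMixin X.
HB.instance Definition _ := gen_choiceMixin X.

Definition in_simplex (A : set V) (x : X) : Prop := [set v | x v != 0] `<=` A.

(* The barycentric simplex has edges of length [sqrt 2]. *)
Definition simplex_dist (x y : X) : R :=
  Num.sqrt ((\sum_(v \in [set: V]) (x v - y v) ^+ 2) / 2).

(* [pl_path x y l]: a path of length [l] from [x] to [y], composed of finitely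
   many straight segments each contained in a closed simplex. *)
Inductive pl_path : X -> X -> R -> Prop :=
| pl_nil x : pl_path x x 0
| pl_cons A x y z l : K A -> in_simplex A x -> in_simplex A y ->
    pl_path y z l -> pl_path x z (simplex_dist x y + l).

(* Extended-valued, being [+oo] between distinct connected components. *)
Definition length_dist (x y : X) : \bar R :=
  ereal_inf [set l%:E | l in pl_path x y].

Let length_ball (x : X) (e : R) : set X := [set y | (length_dist x y < e%:E)%E].

Lemma simplex_distC x y : simplex_dist x y = simplex_dist y x.
Proof.
by rewrite /simplex_dist; under eq_fsbigr do rewrite -sqrrN opprB.
Qed.

Lemma pl_path_cat x y z l k : pl_path x y l -> pl_path y z k ->
  pl_path x z (l + k).
Proof.
elim=> [w|A u v w m KA Au Av _ IH] wz; first by rewrite add0r.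
by rewrite -addrA; apply: pl_cons KA Au Av (IH wz).
Qed.

Lemma pl_path_sym x y l : pl_path x y l -> pl_path y x l.
Proof.
elim=> [w|A u v w m KA Au Av _ IH]; first exact: pl_nil.
rewrite addrC; apply: pl_path_cat IH _.
by rewrite simplex_distC -[simplex_dist v u]addr0; apply: pl_cons KA Av Au (pl_nil u).
Qed.

Lemma length_ballP x e y :
  length_ball x e y <-> exists2 l, pl_path x y l & l < e.
Proof.
split=> [/ereal_inf_lt[_ [l xyl <-]]|[l xyl le]]; first by exists l.
by apply: (@le_lt_trans _ _ l%:E); [apply: ereal_inf_lbound; exists l|].
Qed.

Let length_ball_center x (e : R) : 0 < e -> length_ball x e x.
Proof. by move=> e0; apply/length_ballP; exists 0 => //; exact: pl_nil. Qed.

Let length_ball_sym x y (e : R) : length_ball x e y -> length_ball y e x.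
Proof.
by move=> /length_ballP[l /pl_path_sym xyl le]; apply/length_ballP; exists l.
Qed.

Let length_ball_triangle x y z (e1 e2 : R) :
  length_ball x e1 y -> length_ball y e2 z -> length_ball x (e1 + e2) z.
Proof.
move=> /length_ballP[l xyl le1] /length_ballP[k yzk ke2]; apply/length_ballP.
by exists (l + k); [exact: pl_path_cat xyl yzk | exact: ltrD].
Qed.

HB.instance Definition _ := hasNbhs.Build X (nbhs_ (entourage_ length_ball)).
HB.instance Definition _ := @Nbhs_isPseudoMetric.Build R X
  (entourage_ length_ball) erefl length_ball
  length_ball_center length_ball_sym length_ball_triangle erefl.

Lemma ball_length_dist (x : X) (e : R) :
  ball x e = [set y | (length_dist x y < e%:E)%E].
Proof. by []. Qed.

Definition contracting_map (f : X -> X) : Prop :=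
  exists k (lambda : R), [/\ (0 < k)%N, 0 < lambda < 1 &
    forall x y, (length_dist (iter k f x) (iter k f y)
                 <= lambda%:E * length_dist x y)%E].

End Realization.
Arguments realization : clear implicits.
Arguments realization R {V} K.

Section Realize.
Variables (R : realType) (V W : choiceType).
Variables (K : set (set V)) (L : set (set W)) (f : V -> W).

Definition pushforward (x : V -> R) (w : W) : R :=
  \sum_(v \in f @^-1` [set w]) x v.

Lemma pushforward_ge0 (x : realization R K) w : 0 <= pushforward x w.
Proof. by apply: fsumr_ge0 => v _; exact: bary_ge0. Qed.

Lemma pushforward_supp (x : realization R K) :
  [set w | pushforward x w != 0] = f @` [set v | x v != 0].
Proof.
apply/seteqP; split=> [w /= fw0|_ [v /= xv0 <-]].
  apply: contrapT => nw; move/eqP: fw0; apply; apply: fsbig1 => v /= fvw.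
  by apply: contrapT => /eqP xv0; apply: nw; exists v.
have fin : finite_set (f @^-1` [set f v] `&` [set u | x u != 0]).
  exact: finite_setIr (bary_fin x).
have -> : pushforward x (f v) =
    \sum_(u \in f @^-1` [set f v] `&` [set u | x u != 0]) x u.
  rewrite /pushforward; apply/esym/fsbig_widen; first by move=> u [].
  by move=> u [/= fu nu]; apply: contrapT => /eqP xu0; apply: nu.
rewrite (fsbigD1 v) //=; apply: lt0r_neq0; apply: ltr_wpDr.
  by apply: fsumr_ge0 => u _; exact: bary_ge0.
by rewrite lt_def xv0 bary_ge0.
Qed.

Lemma pushforward_fin (x : realization R K) :
  finite_set [set w | pushforward x w != 0].
Proof. by rewrite pushforward_supp; apply: finite_image; exact: bary_fin. Qed.

Lemma pushforward_sum (x : realization R K) :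
  \sum_(w \in [set: W]) pushforward x w = 1.
Proof.
pose D := [set v | x v != 0]; have Dfin : finite_set D := bary_fin x.
rewrite -(bary_sum x).
have -> : \sum_(v \in [set: V]) x v = \sum_(v \in D) x v.
  apply/esym/fsbig_widen => // v [_ nv]; apply: contrapT => /eqP xv0.
  exact: nv.
have -> : \sum_(w \in [set: W]) pushforward x w =
    \sum_(w \in f @` D) pushforward x w.
  apply/esym/fsbig_widen => // w [_ nw] /=; apply: contrapT => /eqP w0.
  by apply: nw; rewrite /D -pushforward_supp.
have E w : pushforward x w = \sum_(v \in D) (if f v == w then x v else 0).
  have -> : \sum_(v \in D) (if f v == w then x v else 0) =
      \sum_(v \in D `&` f @^-1` [set w]) x v.
    rewrite fsbig_mkcondr; apply: eq_fsbigr => v _.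
    by congr (if _ then _ else _); apply/eqP/idP => [fvw|]; rewrite inE.
  apply/esym/fsbig_widen => [v []//|v [/= fvw nv]]; apply: contrapT => /eqP xv0.
  exact: nv.
under eq_fsbigr do rewrite E.
rewrite exchange_fsbig //; last exact: finite_image.
apply: eq_fsbigr => v /[!inE] Dv.
rewrite (fsbigD1 (f v)) /=; [|exact: finite_image|by exists v].
rewrite eqxx fsbig1 ?addr0 // => w [_ /= wfv].
by case: eqP => // fvw; case: wfv.
Qed.

Hypothesis fKL : simplicial_map K L f.

Lemma pushforward_simplex (x : realization R K) :
  L [set w | pushforward x w != 0].
Proof. by rewrite pushforward_supp; apply: fKL; exact: bary_simplex. Qed.

Definition realize (x : realization R K) : realization R L :=
  Realization (pushforward_ge0 x) (pushforward_fin x) (pushforward_sum x)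
    (pushforward_simplex x).

End Realize.
Arguments realize R {V W K L f} fKL x.

(** * Rips complexes *)

Section Rips.
Variables (R : realType) (G : groupType) (T : set G).

Definition rips : set (set G) :=
  [set A | A !=set0 /\ forall g, A g -> [set (h * g^-1)%g | h in A] `<=` T].

Lemma rips_mulr (g : G) : simplicial_map rips rips (fun h => (h * g)%g).
Proof.
move=> A [[a Aa] AT]; split; first by exists (a * g)%g, a.
move=> _ [b Ab <-] _ [_ [c Ac <-] <-]; apply: (AT b Ab); exists c => //.
by rewrite invgM mulgA mulgK.
Qed.

Definition rips_act (x : realization R rips) (g : G) : realization R rips :=
  realize R (rips_mulr g) x.

End Rips.

(** * Homotopies *)

(* Joint continuity makes every intermediate map [H t] continuous. *)
Definition homotopic_through (R : realType) (X Y : topologicalType)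
    (P : set (X -> Y)) (f g : X -> Y) : Prop :=
  exists H : R -> X -> Y,
    [/\ {within `[0, 1] `*` [set: X], continuous (fun p : R * X => H p.1 p.2)},
        H 0 = f, H 1 = g & forall t : R, t \in `[0, 1] -> P (H t)].

(* Main.v *)
From HB Require Import structures.
Require Import Defs.
From mathcomp Require Import all_boot all_order all_algebra finmap.
From mathcomp Require Import all_classical all_reals all_analysis.
From mathcomp Require Import lra ring.
Set Implicit Arguments.
Unset Strict Implicit.
Unset Printing Implicit Defensive.
Import Order.TTheory GRing.Theory Num.Theory.
Import numFieldNormedType.Exports.
Local Open Scope classical_set_scope.
Local Open Scope ring_scope.

(** The proof rests on one consequence of contraction: the displacement
    [F^n(g) F^n(h)^-1] is a section [(g h^-1)|_v] at a word [v] of length [n]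
    ([iter_transversal_map_div]).  Let [N] be the finite set given by contraction
    and choose [l] with [N] contained in [S^l].  For [m = 3 l] the set [S^m] is
    finite, so a single [n] brings all its sections at words of length [n] into
    [N].  Hence [F^n] maps every simplex [A] of the Rips complex of [S^m] to a
    set whose displacements lie in [N]: far smaller than a simplex is allowed to
    be.  The room left is used to blur [F^n].

    The contracting map sends a vertex [g] to the uniform probability measure on
    the finite set [N F^n(g)] and is affine on simplices.  All points of
    [N F^n(A)] differ by elements of [N N N^-1], which is contained in [S^m], so
    this is a map of the complex to itself; for the same reason the point and its
    image under [F^n] lie in a common simplex, and the straight segments between
    them form a homotopy.  Everything is written in terms of left translates
    [N F^n(g)], and [F^n(g h) = F^n(g) phi^n(h)], so every intermediate map is
    equivariant for right translations.

    The blurred map contracts because the measures attached to the vertices of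
    one simplex [A] overlap: [F^n(a)] belongs to [N F^n(g)] for all [a], [g] in
    [A].  This is Doeblin's argument: a Markov kernel whose rows share an atom of
    mass [eps] shrinks the l1-norm of measures of total mass zero by the factor
    [1 - eps] ([kernel_push_contract]).  The metric of the complex is Euclidean
    rather than l1 on each simplex, but the number of vertices of a simplex is at
    most the cardinality of [S^m], so the two are comparable, and passing to a
    high iterate absorbs the constants ([l1_contracting_map]). *)

(** * Markov kernels between vertex sets *)

Lemma fsum_support (R : nmodType) (T : choiceType) (D : set T) (f : T -> R) :
  finite_set D -> (forall v, ~ D v -> f v = 0) ->
  \sum_(v \in [set: T]) f v = \sum_(v <- fset_set D) f v.
Proof.
move=> Dfin f0; rewrite -(@fsbig_widen _ _ _ _ D) ?fsbig_finite//.
by move=> v [_]; exact: f0.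
Qed.

(** A family of finitely supported probability measures on [W] indexed by [V]:
    the vertex data of a map that is affine on simplices. *)
Record markov_kernel (R : realType) (V W : choiceType) := MarkovKernel {
  kernel_fun :> V -> W -> R;
  kernel_ge0 : forall v w, 0 <= kernel_fun v w;
  kernel_fin : forall v, finite_set [set w | kernel_fun v w != 0];
  kernel_sum : forall v, \sum_(w \in [set: W]) kernel_fun v w = 1
}.

Section KernelPush.
Variables (R : realType) (V W : choiceType) (k : markov_kernel R V W).

Definition kernel_image (A : set V) : set W :=
  [set w | exists2 v, A v & k v w != 0].

(* The argument ranges over all functions, not only points of a realization:
   the estimates below concern differences of two points. *)
Definition kernel_push (c : V -> R) (w : W) : R :=
  \sum_(v \in [set: V]) c v * k v w.

Lemma kernel_image_fin D : finite_set D -> finite_set (kernel_image D).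
Proof.
move=> Dfin.
have -> : kernel_image D = \bigcup_(v in D) [set w | k v w != 0].
  by apply/seteqP; split=> w [v Dv kvw]; exists v.
by apply: bigcup_finite => // v _; exact: kernel_fin.
Qed.

Section Support.
Variables (D : set V) (c : V -> R).
Hypotheses (Dfin : finite_set D) (c_out : forall v, ~ D v -> c v = 0).

Lemma kernel_pushE w : kernel_push c w = \sum_(v <- fset_set D) c v * k v w.
Proof. by apply: fsum_support => // v /c_out ->; rewrite mul0r. Qed.

Lemma kernel_push_out w : ~ kernel_image D w -> kernel_push c w = 0.
Proof.
move=> Dw; apply: fsbig1 => v _; have [Dv|/c_out->] := pselect (D v); last first.
  by rewrite mul0r.
have [->|kvw] := eqVneq (k v w) 0; first by rewrite mulr0.
by case: Dw; exists v.
Qed.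

Lemma kernel_sum_seq (E : set W) v : finite_set E -> kernel_image D `<=` E ->
  D v -> \sum_(w <- fset_set E) k v w = 1.
Proof.
move=> Efin DE Dv; rewrite -(kernel_sum k v); apply/esym/fsum_support => // w Ew.
by have [//|kvw] := eqVneq (k v w) 0; case: Ew; apply: DE; exists v.
Qed.

Lemma kernel_push_sum :
  \sum_(w \in [set: W]) kernel_push c w = \sum_(v \in [set: V]) c v.
Proof.
rewrite (fsum_support (kernel_image_fin Dfin) kernel_push_out).
under eq_bigr do rewrite kernel_pushE.
rewrite exchange_big /= (fsum_support Dfin c_out).
apply: eq_big_seq => v; rewrite in_fset_set// inE => Dv.
by rewrite -mulr_sumr kernel_sum_seq ?mulr1//; exact: kernel_image_fin.
Qed.

(** Doeblin's argument: since [c] has total mass zero, subtracting the same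
    measure [eps] at [w0] from all [k v] does not change the image of [c], while
    the remaining measures are nonnegative of mass [1 - eps].  With [eps = 0] it
    says that kernels do not expand the l1-norm. *)
Lemma kernel_push_contract w0 (eps : R) :
  \sum_(v \in [set: V]) c v = 0 -> (forall v, D v -> eps <= k v w0) ->
  \sum_(w \in [set: W]) `|kernel_push c w| <=
    (1 - eps) * \sum_(v \in [set: V]) `|c v|.
Proof.
move=> c0 eps_k; pose E := kernel_image D `|` [set w0].
have Efin : finite_set E.
  by rewrite finite_setU; split; [exact: kernel_image_fin|exact: finite_set1].
rewrite (fsum_support Efin); last first.
  by move=> w Ew; rewrite kernel_push_out ?normr0// => Dw; apply: Ew; left.
rewrite (fsum_support (f := fun v => `|c v|) Dfin); last first.
  by move=> v /c_out ->; rewrite normr0.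
have cD0 : \sum_(v <- fset_set D) c v = 0 by rewrite -(fsum_support Dfin).
pose j w : R := if w == w0 then eps else 0.
have j_sum : \sum_(w <- fset_set E) j w = eps.
  rewrite (big_rem w0) ?in_fset_set ?inE//=; last by right.
  rewrite /j eqxx big_seq big1 ?addr0// => w.
  by rewrite rem_filter ?fset_uniq// mem_filter /= => /andP[/negPf ->].
have push_j w : kernel_push c w = \sum_(v <- fset_set D) c v * (k v w - j w).
  rewrite kernel_pushE; under [RHS]eq_bigr do rewrite mulrBr.
  by rewrite big_split /= sumrN -mulr_suml cD0 mul0r subr0.
apply: (@le_trans _ _ (\sum_(w <- fset_set E) \sum_(v <- fset_set D)
                         `|c v| * (k v w - j w))).
  apply: ler_sum => w _; rewrite push_j; apply: le_trans (ler_norm_sum _ _ _) _.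
  rewrite big_seq [leRHS]big_seq; apply: ler_sum => v.
  rewrite in_fset_set// inE => Dv; rewrite normrM ler_wpM2l// ger0_norm//.
  by rewrite subr_ge0 /j; case: eqP => [->|_]; [exact: eps_k|exact: kernel_ge0].
rewrite exchange_big /= mulr_sumr big_seq [leRHS]big_seq; apply: ler_sum => v.
rewrite in_fset_set// inE => Dv; rewrite -mulr_sumr big_split /= sumrN j_sum.
by rewrite kernel_sum_seq//; [rewrite mulrC|move=> w; left].
Qed.

End Support.
End KernelPush.

Section KernelMap.
Variables (R : realType) (V W : choiceType).
Variables (K : set (set V)) (L : set (set W)) (k : markov_kernel R V W).
Implicit Types x y : realization R K.

(** The support of the image of a point with support [A] is exactly
    [kernel_image k A], see [kernel_push_supp]. *)
Definition kernel_simplicial : Prop := forall A, K A -> L (kernel_image k A).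

Lemma kernel_push_ge0 x w : 0 <= kernel_push k x w.
Proof.
by apply: fsumr_ge0 => v _; apply: mulr_ge0; [exact: bary_ge0|exact: kernel_ge0].
Qed.

Lemma bary_out x v : ~ [set v | x v != 0] v -> x v = 0.
Proof. by move=> /negP/negPn/eqP. Qed.

Lemma kernel_push_supp x :
  [set w | kernel_push k x w != 0] = kernel_image k [set v | x v != 0].
Proof.
apply/seteqP; split=> w /=.
  move=> /eqP kxw; apply: contrapT => nw; apply: kxw.
  by apply: kernel_push_out nw => v; exact: bary_out.
case=> v /= xv kvw; apply: lt0r_neq0.
rewrite (kernel_pushE k (bary_fin x) (@bary_out x)).
rewrite (big_rem v) ?in_fset_set ?inE//=; last exact: bary_fin.
rewrite ltr_wpDr ?mulr_gt0 ?lt_def ?xv ?kvw ?bary_ge0 ?kernel_ge0//.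
by apply: sumr_ge0 => u _; rewrite mulr_ge0 ?bary_ge0 ?kernel_ge0.
Qed.

Lemma kernel_push_fin x : finite_set [set w | kernel_push k x w != 0].
Proof.
by rewrite kernel_push_supp; apply: kernel_image_fin; exact: bary_fin.
Qed.

Lemma kernel_push_sum1 x : \sum_(w \in [set: W]) kernel_push k x w = 1.
Proof.
by rewrite (kernel_push_sum k (bary_fin x) (@bary_out x)); exact: bary_sum.
Qed.

Hypothesis kKL : kernel_simplicial.

Lemma kernel_push_simplex x : L [set w | kernel_push k x w != 0].
Proof. by rewrite kernel_push_supp; apply: kKL; exact: bary_simplex. Qed.

Definition kernel_map x : realization R L :=
  Realization (kernel_push_ge0 x) (kernel_push_fin x) (kernel_push_sum1 x)
    (kernel_push_simplex x).

Lemma in_simplex_kernel_map A x :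
  in_simplex A x -> in_simplex (kernel_image k A) (kernel_map x).
Proof.
move=> Ax w /= kxw; have : [set w | kernel_push k x w != 0] w by [].
by rewrite kernel_push_supp => -[v /Ax Av kvw]; exists v.
Qed.

End KernelMap.

(** * Comparison of the Euclidean metric with the l1-metric *)

Section L1.
Variables (R : realType) (V : choiceType).

Definition l1_dist (x y : V -> R) : R := \sum_(v \in [set: V]) `|x v - y v|.

Variable (K : set (set V)).
Implicit Types x y : realization R K.

Lemma subr_out (A : set V) x y : in_simplex A x -> in_simplex A y ->
  forall v, ~ A v -> x v - y v = 0.
Proof.
move=> Ax Ay v Av; rewrite (bary_out (x := x)) => [|/Ax//].
by rewrite (bary_out (x := y)) ?subr0 => [|/Ay].
Qed.

Lemma l1_dist_ge0 x y : 0 <= l1_dist x y.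
Proof. by apply: fsumr_ge0. Qed.

Lemma common_support x y : exists2 D : set V,
  finite_set D & in_simplex D x /\ in_simplex D y.
Proof.
exists ([set v | x v != 0] `|` [set v | y v != 0]).
  by rewrite finite_setU; split; exact: bary_fin.
by split=> v /= xv; [left|right].
Qed.

Lemma simplex_dist_le_l1 x y : simplex_dist x y <= l1_dist x y.
Proof.
have [D Dfin [Dx Dy]] := common_support x y.
rewrite /simplex_dist -[leRHS]ger0_norm ?l1_dist_ge0// -sqrtr_sqr.
rewrite ler_wsqrtr//; apply: (@le_trans _ _ (\sum_(v \in [set: V]) (x v - y v) ^+ 2)).
  by rewrite ler_pdivrMr// ler_peMr ?ler1n// fsumr_ge0// => v _; exact: sqr_ge0.
rewrite [leRHS]expr2 {1}/l1_dist; have out := subr_out Dx Dy.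
rewrite (fsum_support Dfin) => [|v /out ->]; last by rewrite expr0n.
rewrite (fsum_support Dfin) => [|v /out ->]; last by rewrite normr0.
rewrite mulr_suml big_seq [leRHS]big_seq.
apply: ler_sum => v; rewrite in_fset_set// inE => Dv.
rewrite -real_normK ?num_real// expr2 ler_wpM2l//.
rewrite /l1_dist (fsum_support Dfin) => [|u /out ->]; last by rewrite normr0.
by rewrite (big_rem v) ?in_fset_set ?inE//= lerDl sumr_ge0.
Qed.

(** Each coordinate is bounded by the Euclidean norm; the crude constant 2 per
    vertex covers the normalization of the edges. *)
Lemma l1_dist_le_simplex (A : set V) (M : nat) x y : finite_set A ->
  (#|` fset_set A| <= M)%N -> in_simplex A x -> in_simplex A y ->
  l1_dist x y <= (2 * M)%:R * simplex_dist x y.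
Proof.
move=> Afin AM Ax Ay; have out := subr_out Ax Ay.
have d0 : 0 <= simplex_dist x y by exact: sqrtr_ge0.
have coord v : v \in fset_set A -> `|x v - y v| <= 2 * simplex_dist x y.
  move=> Av; rewrite -(@ler_pXn2r _ 2) ?nnegrE ?mulr_ge0//.
  rewrite exprMn sqr_sqrtr; last first.
    by rewrite divr_ge0 ?fsumr_ge0// => u _; exact: sqr_ge0.
  rewrite real_normK ?num_real//.
  apply: (@le_trans _ _ (\sum_(v \in [set: V]) (x v - y v) ^+ 2)).
    rewrite (fsum_support Afin) => [|u /out ->]; last by rewrite expr0n.
    by rewrite (big_rem v)//= lerDl sumr_ge0// => u _; exact: sqr_ge0.
  have : 0 <= \sum_(v \in [set: V]) (x v - y v) ^+ 2.
    by rewrite fsumr_ge0// => u _; exact: sqr_ge0.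
  by move: (\sum_(v \in [set: V]) _) => s s0; lra.
rewrite /l1_dist (fsum_support Afin) => [|u /out ->]; last by rewrite normr0.
apply: (@le_trans _ _ (\sum_(v <- fset_set A) 2 * simplex_dist x y)).
  by rewrite big_seq [leRHS]big_seq; exact: ler_sum.
rewrite big_const_seq count_predT iter_addr_0 -[leLHS]mulr_natr natrM.
by rewrite [leRHS]mulrAC ler_wpM2l ?mulr_ge0// ler_nat.
Qed.

End L1.

Lemma kernel_map_l1_contract (R : realType) (V W : choiceType)
    (K : set (set V)) (L : set (set W)) (k : markov_kernel R V W)
    (kKL : kernel_simplicial K L k) (A : set V) (w0 : W) (eps : R)
    (x y : realization R K) :
  in_simplex A x -> in_simplex A y -> (forall v, A v -> eps <= k v w0) ->
  l1_dist (kernel_map kKL x) (kernel_map kKL y) <= (1 - eps) * l1_dist x y.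
Proof.
move=> Ax Ay eps_k.
pose D := [set v | x v != 0] `|` [set v | y v != 0].
have Dfin : finite_set D by rewrite finite_setU; split; exact: bary_fin.
have Dx : in_simplex D x by move=> v; left.
have Dy : in_simplex D y by move=> v; right.
have out := subr_out Dx Dy.
have sub w : kernel_push k x w - kernel_push k y w =
    kernel_push k (fun v => x v - y v) w.
  rewrite !(kernel_pushE _ Dfin)//; first last.
  - by move=> v Dv; apply: bary_out => /Dx.
  - by move=> v Dv; apply: bary_out => /Dy.
  by rewrite -sumrB; apply: eq_bigr => v _; rewrite mulrBl.
rewrite /l1_dist; under eq_fsbigr do rewrite /= sub.
apply: (kernel_push_contract Dfin out (w0 := w0)).
  rewrite (fsum_support Dfin out) sumrB.
  rewrite -!(fsum_support Dfin) ?bary_sum ?subrr//.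
  - by move=> v Dv; apply: bary_out => /Dy.
  - by move=> v Dv; apply: bary_out => /Dx.
by move=> v [/Ax|/Ay]; exact: eps_k.
Qed.

Lemma fsum_neq0 (R : realType) (T : choiceType) (f : T -> R) :
  \sum_(v \in [set: T]) f v = 1 -> exists v, f v != 0.
Proof.
move=> f1; apply: contrapT => f0; have := oner_neq0 R.
rewrite -f1 fsbig1 ?eqxx// => v _; apply: contrapT => /eqP fv.
by apply: f0; exists v.
Qed.

Lemma realization_eq (R : realType) (V : choiceType) (K : set (set V))
  (x y : realization R K) : x =1 y -> x = y.
Proof.
case: x => x x0 xf x1 xs; case: y => y y0 yf y1 ys /= /funext xy.
by subst y; congr Realization; exact: Prop_irrelevance.
Qed.

Lemma l1_dist_le2 (R : realType) (V : choiceType) (K : set (set V))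
  (x y : realization R K) : l1_dist x y <= 2.
Proof.
have [D Dfin [Dx Dy]] := common_support x y; have out := subr_out Dx Dy.
rewrite /l1_dist (fsum_support Dfin) => [|v /out ->]; last by rewrite normr0.
have <- : \sum_(v <- fset_set D) x v + \sum_(v <- fset_set D) y v = 2.
  rewrite -!(fsum_support Dfin) ?bary_sum//.
  - by move=> v Dv; apply: bary_out => /Dy.
  - by move=> v Dv; apply: bary_out => /Dx.
rewrite -big_split /=; apply: ler_sum => v _.
by rewrite (le_trans (ler_normB _ _))// !ger0_norm ?bary_ge0.
Qed.

(** * Lipschitz maps of realizations *)

Section Lipschitz.
Variables (R : realType) (V W : choiceType).
Variables (K : set (set V)) (L : set (set W)).
Local Notation X := (realization R K).
Local Notation Y := (realization R L).

Lemma length_dist_simplex A (x y : X) : K A -> in_simplex A x ->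
  in_simplex A y -> (length_dist x y <= (simplex_dist x y)%:E)%E.
Proof.
move=> KA Ax Ay; apply: ereal_inf_lbound; exists (simplex_dist x y) => //.
by rewrite -[simplex_dist x y]addr0; apply: pl_cons KA Ax Ay (pl_nil y).
Qed.

(** A bound on the simplices suffices for the length metric, because paths are
    made of segments in simplices and [f] takes such paths to such paths. *)
Definition simplexwise_lipschitz (a : R) (f : X -> Y) : Prop :=
  forall A x y, K A -> in_simplex A x -> in_simplex A y ->
  exists B, [/\ L B, in_simplex B (f x), in_simplex B (f y) &
    simplex_dist (f x) (f y) <= a * simplex_dist x y].

Lemma pl_path_lipschitz a f x y l : simplexwise_lipschitz a f ->
  pl_path x y l -> exists2 l', pl_path (f x) (f y) l' & l' <= a * l.
Proof.
move=> fa; elim=> {x y l} [x|A x y z l KA Ax Ay _ [l' fyz l'l]].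
  by exists 0; [exact: pl_nil|rewrite mulr0].
have [B [LB Bx By fxy]] := fa _ _ _ KA Ax Ay.
exists (simplex_dist (f x) (f y) + l'); first exact: pl_cons LB Bx By fyz.
by rewrite mulrDr lerD.
Qed.

Lemma length_dist_lipschitz a f : 0 < a -> simplexwise_lipschitz a f ->
  forall x y, (length_dist (f x) (f y) <= a%:E * length_dist x y)%E.
Proof.
move=> a0 fa x y; rewrite -lee_pdivrMl//.
apply: le_ereal_inf_tmp => _ [l xyl <-].
have [l' fxy l'l] := pl_path_lipschitz fa xyl.
rewrite lee_pdivrMl//; apply: (@le_trans _ _ l'%:E).
  by apply: ereal_inf_lbound; exists l'.
by rewrite -EFinM lee_fin.
Qed.

Lemma lipschitz_ball a f x y e : 0 < a -> simplexwise_lipschitz a f ->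
  ball x (e / a) y -> ball (f x) e (f y).
Proof.
move=> a0 fa; rewrite !ball_length_dist /= => xy.
apply: le_lt_trans (length_dist_lipschitz a0 fa x y) _.
by rewrite muleC -lte_pdivlMr// -EFinM.
Qed.

Lemma lipschitz_continuous a f :
  0 < a -> simplexwise_lipschitz a f -> continuous f.
Proof.
move=> a0 fa x; apply: (iffRL (@cvg_ballP R Y X _ (nbhs_filter x) f (f x))) => e e0.
 apply/nbhs_ballP.
by exists (e / a); [exact: divr_gt0|move=> y; exact: lipschitz_ball].
Qed.

Lemma joint_continuous a b (H : R -> X -> Y) : 0 < a -> 0 < b ->
  (forall t, simplexwise_lipschitz a (H t)) ->
  (forall s t x, (length_dist (H s x) (H t x) <= (b * `|s - t|)%:E)%E) ->
  continuous (fun p : R * X => H p.1 p.2).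
Proof.
move=> a0 b0 Ha Hb [t x].
apply: (iffRL (@cvg_ballP R Y _ _ (nbhs_filter (t, x)) _ _)) => e e0 /=.
exists (ball t (e / 2 / b), ball x (e / 2 / a)).
  by split; apply: nbhsx_ballx; rewrite !divr_gt0.
move=> [s y] [/= ts xy]; rewrite [e]splitr.
apply: (@ball_triangle _ _ (H s x)); last exact: lipschitz_ball xy.
rewrite ball_length_dist /=; apply: le_lt_trans (Hb _ _ _) _.
by rewrite lte_fin mulrC -ltr_pdivlMr.
Qed.

End Lipschitz.

(** On simplices with at most [M] vertices the Euclidean and l1-metrics agree up
    to a constant [a]; a power [k] with [a * theta ^+ k < 1] absorbs it. *)
Lemma l1_contracting_map (R : realType) (V : choiceType) (K : set (set V))
    (M : nat) (theta : R) (f : realization R K -> realization R K) :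
  (forall A, K A -> finite_set A /\ (#|` fset_set A| <= M)%N) ->
  0 < theta < 1 ->
  (forall A x y, K A -> in_simplex A x -> in_simplex A y ->
    exists B, [/\ K B, in_simplex B (f x), in_simplex B (f y) &
      l1_dist (f x) (f y) <= theta * l1_dist x y]) ->
  contracting_map f.
Proof.
move=> KM /andP[theta0 theta1] f_l1.
have iter_l1 k A x y : K A -> in_simplex A x -> in_simplex A y ->
    exists B, [/\ K B, in_simplex B (iter k f x), in_simplex B (iter k f y) &
      l1_dist (iter k f x) (iter k f y) <= theta ^+ k * l1_dist x y].
  move=> KA Ax Ay; elim: k => [|k [B [KB Bx By xyk]]].
    by exists A; split=> //=; rewrite mul1r.
  have [C [KC Cx Cy Cxy]] := f_l1 _ _ _ KB Bx By.
  exists C; split => //=; apply: le_trans Cxy _.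
  by rewrite exprS -mulrA ler_wpM2l// ltW.
(* The successor makes the constant positive even when [M = 0]. *)
pose a : R := (2 * M.+1)%:R; have a0 : 0 < a by rewrite ltr0n.
have [k k0 ka] : exists2 k, (0 < k)%N & theta ^+ k < a^-1.
  have /cvgrPdist_lt/(_ a^-1) : theta ^+ n @[n --> \oo] --> (0 : R).
    by apply: cvg_expr; rewrite gtr0_norm.
  rewrite invr_gt0 => /(_ a0)[n _ nP]; exists n.+1 => //.
  by have := nP n.+1 (leqnSn n); rewrite /= sub0r normrN gtr0_norm ?exprn_gt0.
have ak0 : 0 < a * theta ^+ k by rewrite mulr_gt0// exprn_gt0.
exists k, (a * theta ^+ k); split=> //.
  by rewrite ak0 /= mulrC -ltr_pdivlMr// div1r.
apply: length_dist_lipschitz => // A x y KA Ax Ay.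
have [B [KB Bx By xyk]] := iter_l1 k _ _ _ KA Ax Ay.
exists B; split=> //; apply: le_trans (simplex_dist_le_l1 _ _) _.
apply: (le_trans xyk); rewrite [a * _]mulrC -mulrA.
apply: ler_wpM2l; first by rewrite exprn_ge0// ltW.
have [Afin AM] := KM _ KA.
exact: (l1_dist_le_simplex Afin (leq_trans AM (leqnSn M)) Ax Ay).
Qed.

(** * Powers of a generating set and simplices of Rips complexes *)

(** Used twice: to put the finite set [N] into one power of [S], and to find one
    length of words that works for all elements of [S^m]. *)
Lemma finite_uniform (T : choiceType) (A : set T) (P : nat -> T -> Prop) :
  finite_set A -> (forall m n x, (m <= n)%N -> P m x -> P n x) ->
  (forall x, A x -> exists n, P n x) -> exists n, forall x, A x -> P n x.
Proof.
move=> /finite_seqP[s ->] P_mono; elim: s => [|a s IHs] sP; first by exists 0%N.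
have [m Pm] := sP a (mem_head a s).
have [|n Pn] := IHs; first by move=> x xs; apply: sP; rewrite /= inE xs orbT.
exists (maxn m n) => x /=; rewrite inE => /orP[/eqP->|/Pn].
  exact: P_mono (leq_maxl m n) Pm.
exact: P_mono (leq_maxr m n).
Qed.

Section Setpow.
Variables (G : groupType) (S : set G).

Lemma setpow1 g : S g -> setpow S 1 g.
Proof. by move=> Sg; exists (fun=> g) => //; rewrite big_ord1. Qed.

Lemma setpowM m n g h :
  setpow S m g -> setpow S n h -> setpow S (m + n) (g * h)%g.
Proof.
move=> [s Ss <-] [t St <-].
exists (fun i => match fintype.split i with inl j => s j | inr j => t j end).
  by move=> i; case: fintype.split.
rewrite big_split_ord; congr (_ * _)%g; apply: eq_bigr => i _.
  by rewrite -[lshift n i]/(unsplit (inl i)) unsplitK.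
by rewrite -[rshift m i]/(unsplit (inr i)) unsplitK.
Qed.

Lemma setpow_fin m : finite_set S -> finite_set (setpow S m).
Proof.
move=> Sfin; elim: m => [|m IHm].
  by apply: (sub_finite_set _ (finite_set1 1%g)) => _ [s _ <-]; rewrite big_ord0.
apply: sub_finite_set (finite_image2 (fun g h => g * h)%g Sfin IHm).
move=> _ [s Ss <-]; rewrite big_ord_recl; exists (s ord0) => //.
by exists (\prod_(i < m) s (lift ord0 i))%g => //; exists (fun i => s (lift ord0 i)).
Qed.

Hypothesis S1 : S 1%g.

Lemma setpow_one m : setpow S m 1%g.
Proof. by exists (fun=> 1%g) => //; rewrite big1. Qed.

Lemma setpow_le m n g : (m <= n)%N -> setpow S m g -> setpow S n g.
Proof.
by move=> mn Smg; rewrite -(subnKC mn) -[g]mulg1; apply: setpowM Smg (setpow_one _).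
Qed.

Hypothesis SV : [set s^-1%g | s in S] = S.

Lemma setpowV m g : setpow S m g -> setpow S m (g^-1)%g.
Proof.
move=> [s Ss <-]; elim: m s Ss => [|m IHm] s Ss.
  by rewrite big_ord0 invg1; exact: setpow_one.
rewrite big_ord_recl invgM.
suff : setpow S (m + 1) ((\prod_(i < m) s (lift ord0 i))^-1 * (s ord0)^-1)%g.
  by rewrite addn1.
apply: setpowM.
  exact: (IHm (fun i => s (lift ord0 i))).
by apply: setpow1; rewrite -SV; exists (s ord0).
Qed.

Lemma generates_setpow : generates S -> forall g, exists m, setpow S m g.
Proof.
move=> Sgen g.
pose H : {pred G} := fun g => `[< exists m, setpow S m g >].
have HM : {in H &, forall x y, (x * y)%g \in H}.
  move=> x y /asboolP[m mx] /asboolP[n ny]; apply/asboolP.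
  by exists (m + n)%N; exact: setpowM.
have H1 : 1%g \in H by apply/asboolP; exists 0%N; exact: setpow_one.
have HV : {in H, forall x, (x^-1)%g \in H}.
  by move=> x /asboolP[m mx]; apply/asboolP; exists m; exact: setpowV.
pose m1 := isMulClosed.Build G H HM.
pose m2 := isMul1Closed.Build G H H1.
pose m3 := isInvClosed.Build G H HV.
pose H' : groupClosed G := HB.pack H m1 m2 m3.
have : [set` H'] = [set: G].
  by apply: Sgen => s Ss /=; apply/asboolP; exists 1%N; exact: setpow1.
by move/seteqP => -[_ /(_ g I)] /asboolP.
Qed.

End Setpow.

Lemma rips_card (G : groupType) (T A : set G) : finite_set T -> rips T A ->
  finite_set A /\ (#|` fset_set A| <= #|` fset_set T|)%N.
Proof.
move=> Tfin [[a Aa] AT].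
have Asub : A `<=` (fun t => t * a)%g @` T.
  move=> h Ah; exists (h * a^-1)%g; last by rewrite mulgVK.
  by apply: (AT a Aa); exists h.
have fin := finite_image (fun t => t * a)%g Tfin.
have Afin := sub_finite_set Asub fin; split=> //.
have : (fset_set A `<=` fset_set ((fun t => t * a)%g @` T))%fset.
  by rewrite -fset_set_sub.
rewrite fset_set_image// => /fsubset_leq_card/leq_trans; apply; exact: leq_imfset_card.
Qed.

(** * Iterates of the transversal map *)

Section TransversalMap.
Variables (G : groupType) (phi : virtual_endo G) (d : nat) (r : 'I_d.+1 -> G).
Hypothesis r_transversal : coset_transversal phi r.
Local Notation F := (transversal_map phi r).

Lemma coset_idxP g : (r (coset_idx phi r g) * g)%g \in vdom phi.
Proof.
have [_ /(_ g)[i [ri _]]] := r_transversal.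
by rewrite /coset_idx; case: xgetP => [j _ //|/(_ i)].
Qed.

Lemma coset_idx_uniq g i : (r i * g)%g \in vdom phi -> coset_idx phi r g = i.
Proof.
have [_ /(_ g)[j [_ j_uniq]]] := r_transversal.
by move=> /j_uniq <-; apply/esym/j_uniq/coset_idxP.
Qed.

Lemma vfun_div g h : g \in vdom phi -> h \in vdom phi ->
  phi (g * h^-1)%g = (phi g * (phi h)^-1)%g.
Proof.
move=> gD hD; apply: (mulIg (phi h)); rewrite mulgVK -(vfunM (v := phi))//.
  by rewrite mulgVK.
by rewrite gpredF.
Qed.

Lemma transversal_mapM g h : h \in vdom phi -> F (g * h)%g = (F g * phi h)%g.
Proof.
move=> hD; have gD := coset_idxP g; rewrite /transversal_map.
have -> : coset_idx phi r (g * h)%g = coset_idx phi r g.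
  by apply: coset_idx_uniq; rewrite mulgA gpredM.
by rewrite mulgA; exact: vfunM gD hD.
Qed.

Lemma iter_transversal_mapM n g h : iter_dom phi n h ->
  iter n F (g * h)%g = (iter n F g * iter n phi h)%g.
Proof.
elim: n => [//|n IHn] hD /=; rewrite IHn => [|k kn]; last by apply: hD; exact: ltnW.
by rewrite transversal_mapM//; exact: hD.
Qed.

Lemma transversal_map_div g h :
  (F g * (F h)^-1)%g = section_at phi r (g * h^-1)%g (coset_idx phi r h).
Proof.
have gD := coset_idxP g; have hD := coset_idxP h.
have E i : (r i * (g * h^-1) * (r (coset_idx phi r h))^-1)%g =
    (r i * g * (r (coset_idx phi r h) * h)^-1)%g by rewrite invgM !mulgA.
rewrite /section_at (@coset_idx_uniq _ (coset_idx phi r g)); last first.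
  by rewrite mulgA E gpredF.
by rewrite E vfun_div.
Qed.

(** This turns contraction of the sections into contraction of [F]: with
    [i], [j] the indices of the cosets of [g], [h], the index [i] is also the one
    entering the section of [g h^-1] at [j], as
    [r_i (g h^-1) r_j^-1 = (r_i g) (r_j h)^-1]; then iterate. *)
Lemma iter_transversal_map_div n g h : exists2 v : seq 'I_d.+1, size v = n &
  (iter n F g * (iter n F h)^-1)%g = section_word phi r (g * h^-1)%g v.
Proof.
elim: n => [|n [v vn IHn]]; first by exists [::].
exists (rcons v (coset_idx phi r (iter n F h))); first by rewrite size_rcons vn.
by rewrite /section_word foldl_rcons -/(section_word _ _ _ _) -IHn /= transversal_map_div.
Qed.

End TransversalMap.

Section KernelLipschitz.
Variables (R : realType) (V W : choiceType).
Variables (K : set (set V)) (L : set (set W)) (M : nat).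
Hypothesis KM :
  forall A, K A -> finite_set A /\ (#|` fset_set A| <= M)%N.

Lemma kernel_map_lipschitz (k : markov_kernel R V W)
    (kKL : kernel_simplicial K L k) :
  simplexwise_lipschitz (2 * M.+1)%:R (kernel_map kKL).
Proof.
move=> A x y KA Ax Ay; exists (kernel_image k A).
split; [exact: kKL|exact: in_simplex_kernel_map|exact: in_simplex_kernel_map|].
have [w0 _] := fsum_neq0 (bary_sum (kernel_map kKL x)).
apply: le_trans (simplex_dist_le_l1 _ _) _.
apply: le_trans (kernel_map_l1_contract kKL (w0 := w0) (eps := 0) Ax Ay _) _.
  by move=> v _; exact: kernel_ge0.
have [Afin AM] := KM KA; rewrite subr0 mul1r.
exact: (l1_dist_le_simplex Afin (leq_trans AM (leqnSn M)) Ax Ay).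
Qed.

End KernelLipschitz.

(** * Straight-line homotopies *)

Section Clamp.
Variable R : realType.

Definition clamp (t : R) : R := Num.min (Num.max t 0) 1.

Lemma clamp_ge0 t : 0 <= clamp t.
Proof. by rewrite /clamp le_min le_max lexx orbT ler01. Qed.

Lemma clamp_le1 t : clamp t <= 1.
Proof. by rewrite /clamp ge_min lexx orbT. Qed.

Lemma clamp0 : clamp 0 = 0.
Proof. by rewrite /clamp maxxx min_l. Qed.

Lemma clamp1 : clamp 1 = 1.
Proof. by rewrite /clamp max_l ?minxx. Qed.

Lemma clamp_lipschitz s t : `|clamp s - clamp t| <= `|s - t|.
Proof.
have := ler_norm (s - t); have := ler_norm (t - s); rewrite (distrC t s).
rewrite ler_norml /clamp !minEle !maxEle.
by do 4?case: ifPn; rewrite -?ltNge; lra.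
Qed.

End Clamp.

Section InterpKernel.
Variables (R : realType) (V W : choiceType) (k0 k1 : markov_kernel R V W).

(** Clamping the parameter keeps [interp t] a Markov kernel for every real [t],
    and continuity then holds on the whole real line. *)
Definition interp (t : R) v w := (1 - clamp t) * k0 v w + clamp t * k1 v w.

Lemma interp_ge0 t v w : 0 <= interp t v w.
Proof.
by rewrite addr_ge0// mulr_ge0 ?kernel_ge0 ?subr_ge0 ?clamp_le1 ?clamp_ge0.
Qed.

Lemma interp_supp t v w :
  interp t v w != 0 -> k0 v w != 0 \/ k1 v w != 0.
Proof.
rewrite /interp; have [->|] := eqVneq (k0 v w) 0; last by left.
have [->|] := eqVneq (k1 v w) 0; last by right.
by rewrite !mulr0 addr0 eqxx.
Qed.

Lemma interp_fin t v : finite_set [set w | interp t v w != 0].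
Proof.
have fin : finite_set ([set w | k0 v w != 0] `|` [set w | k1 v w != 0]).
  by rewrite finite_setU; split; exact: kernel_fin.
by apply: sub_finite_set fin => w /interp_supp.
Qed.

Lemma interp_sum t v : \sum_(w \in [set: W]) interp t v w = 1.
Proof.
pose D := [set w | k0 v w != 0] `|` [set w | k1 v w != 0].
have Dfin : finite_set D by rewrite finite_setU; split; exact: kernel_fin.
have out0 w : ~ D w -> k0 v w = 0.
  by move=> Dw; apply/eqP/negPn/negP => kw; apply: Dw; left.
have out1 w : ~ D w -> k1 v w = 0.
  by move=> Dw; apply/eqP/negPn/negP => kw; apply: Dw; right.
rewrite (fsum_support Dfin) => [|w Dw]; last first.
  by rewrite /interp out0// out1// !mulr0 addr0.
rewrite big_split /= -!mulr_sumr -!(fsum_support Dfin)// !kernel_sum !mulr1.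
by rewrite subrK.
Qed.

Definition interp_kernel t : markov_kernel R V W :=
  MarkovKernel (interp_ge0 t) (interp_fin t) (interp_sum t).

Lemma interp_push K (x : realization R K) t w :
  kernel_push (interp_kernel t) x w =
  (1 - clamp t) * kernel_push k0 x w + clamp t * kernel_push k1 x w.
Proof.
rewrite !(kernel_pushE _ (bary_fin x) (@bary_out _ _ _ x)) !mulr_sumr.
rewrite -big_split /=; apply: eq_bigr => v _.
by rewrite /interp mulrDr !mulrA ![x v * _]mulrC.
Qed.

Variables (K : set (set V)) (L : set (set W)).
Hypothesis kKL : forall t, kernel_simplicial K L (interp_kernel t).

Lemma interp_map0 (k0KL : kernel_simplicial K L k0) :
  kernel_map (kKL 0) = kernel_map k0KL.
Proof.
apply/funext => x; apply: realization_eq => w /=.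
by rewrite interp_push clamp0 subr0 mul1r mul0r addr0.
Qed.

Lemma interp_map1 (k1KL : kernel_simplicial K L k1) :
  kernel_map (kKL 1) = kernel_map k1KL.
Proof.
apply/funext => x; apply: realization_eq => w /=.
by rewrite interp_push clamp1 subrr mul0r add0r mul1r.
Qed.

(** The points move on a segment whose ends are at l1-distance at most 2. *)
Lemma interp_map_l1 s t (x : realization R K) :
  l1_dist (kernel_map (kKL s) x) (kernel_map (kKL t) x) <= 2 * `|s - t|.
Proof.
have E : l1_dist (kernel_map (kKL s) x) (kernel_map (kKL t) x) =
    `|clamp s - clamp t| *
      l1_dist (kernel_map (kKL 1) x) (kernel_map (kKL 0) x).
  rewrite /l1_dist mulr_fsumr; apply: eq_fsbigr => w _.
  by rewrite -normrM /= !interp_push clamp0 clamp1; congr `|_|; ring.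
rewrite E [leRHS]mulrC ler_pM ?l1_dist_ge0 ?clamp_lipschitz//.
exact: l1_dist_le2.
Qed.

(** The simplex [B] contains both images of a point with support [A], hence the
    whole segment between them, and the homotopy moves along it with speed at
    most 2. *)
Lemma interp_map_continuous (M : nat) :
  (forall A, K A -> finite_set A /\ (#|` fset_set A| <= M)%N) ->
  (forall A, K A -> exists B,
     [/\ L B, kernel_image k0 A `<=` B & kernel_image k1 A `<=` B]) ->
  continuous (fun p : R * realization R K =>
    kernel_map (kKL p.1) p.2 : realization R L).
Proof.
move=> KM hull.
apply: (@joint_continuous _ _ _ _ _ (2 * M.+1)%:R 2 (fun t => kernel_map (kKL t))).
- by rewrite ltr0n.
- by [].
- by move=> t; exact: kernel_map_lipschitz.
move=> s t x; have [B [LB B0 B1]] := hull _ (bary_simplex x).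
have inB u : in_simplex B (kernel_map (kKL u) x).
  move=> w /= kw; have : [set w | kernel_push (interp_kernel u) x w != 0] w by [].
  rewrite kernel_push_supp => -[v xv /interp_supp[kvw|kvw]].
    by apply: B0; exists v.
  by apply: B1; exists v.
apply: le_trans (length_dist_simplex LB (inB s) (inB t)) _.
by rewrite lee_fin (le_trans (simplex_dist_le_l1 _ _))// interp_map_l1.
Qed.

End InterpKernel.

(** * Kernels on Rips complexes *)

Section RipsKernel.
Variables (R : realType) (G : groupType).
Implicit Types (T N : set G) (f : G -> G).

(** Non-empty subsets of simplices are simplices, so it is enough to enclose the
    supports. *)
Lemma rips_kernel_simplicial T (k : markov_kernel R G G) :
  (forall A, rips T A -> exists2 B, rips T B & kernel_image k A `<=` B) ->
  kernel_simplicial (rips T) (rips T) k.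
Proof.
move=> hull A TA; have [B [_ BT] AB] := hull A TA; split.
  have [[a Aa] _] := TA; have [w kaw] := fsum_neq0 (kernel_sum k a).
  by exists w, a.
move=> g /AB Bg _ [h /AB Bh <-]; apply: (BT g Bg); exists h => //.
Qed.

Lemma dirac_ge0 f v w : 0 <= (w == f v)%:R :> R.
Proof. exact: ler0n. Qed.

Lemma dirac_out f v w : ~ [set f v] w -> (w == f v)%:R = 0 :> R.
Proof. by case: eqP. Qed.

Lemma dirac_fin f v : finite_set [set w | (w == f v)%:R != 0 :> R].
Proof.
apply: sub_finite_set (finite_set1 (f v)) => w /=.
by have [->|_] := eqVneq w (f v); rewrite ?eqxx.
Qed.

Lemma dirac_sum f v : \sum_(w \in [set: G]) ((w == f v)%:R : R) = 1.
Proof.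
rewrite (fsum_support (finite_set1 (f v))) => [|w]; last exact: dirac_out.
by rewrite fset_set1 big_seq_fset1 eqxx.
Qed.

Definition dirac_kernel f : markov_kernel R G G :=
  MarkovKernel (dirac_ge0 f) (dirac_fin f) (dirac_sum f).

Lemma dirac_kernel_map T f (fT : simplicial_map (rips T) (rips T) f)
    (kT : kernel_simplicial (rips T) (rips T) (dirac_kernel f)) :
  kernel_map kT = realize R fT.
Proof.
apply/funext => x; apply: realization_eq => w /=.
rewrite /kernel_push /Defs.pushforward [RHS]fsbig_mkcond; apply: eq_fsbigr => v _ /=.
rewrite /patch; have [->|wfv] := eqVneq w (f v).
  by rewrite mulr1 mem_set.
rewrite mulr0 memNset//= => fvw.
by rewrite fvw eqxx in wfv.
Qed.

Lemma card_fset_set_gt0 N g :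
  finite_set N -> N g -> (0 < #|` fset_set N|)%N.
Proof.
by move=> Nfin Ng; rewrite cardfs_gt0; apply/fset0Pn; exists g;
  rewrite in_fset_set ?inE.
Qed.

Section Uniform.
Variables (N : set G) (f : G -> G).
Hypotheses (Nfin : finite_set N) (N1 : N 1%g).

Let card := #|` fset_set N|.

(* The uniform measure on the left translate [N f(v)]. *)
Definition uniform v w : R := ((w * (f v)^-1)%g \in N)%:R / card%:R.

Let card_gt0 : (0 < card)%N.
Proof. exact: card_fset_set_gt0 N1. Qed.

Lemma uniform_ge0 v w : 0 <= uniform v w.
Proof. by rewrite divr_ge0. Qed.

Lemma uniform_supp v w : uniform v w != 0 -> N (w * (f v)^-1)%g.
Proof.
rewrite /uniform; have [/set_mem//|_] := boolP (_ \in N).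
by rewrite mul0r eqxx.
Qed.

Lemma uniform_fin v : finite_set [set w | uniform v w != 0].
Proof.
apply: sub_finite_set (finite_image (fun g => g * f v)%g Nfin) => w /uniform_supp.
by exists (w * (f v)^-1)%g; rewrite ?mulgVK.
Qed.

Lemma uniform_sum v : \sum_(w \in [set: G]) uniform v w = 1.
Proof.
rewrite (@reindex_fsbigT _ _ _ _ _ (fun g => g * f v)%g); last first.
  by exists (fun g => g * (f v)^-1)%g => g; rewrite ?mulgK ?mulgVK.
rewrite (fsum_support Nfin) => [|g Ng]; last first.
  by rewrite /uniform mulgK memNset// mul0r.
rewrite (eq_big_seq (fun=> card%:R^-1)) => [|g]; last first.
  by rewrite in_fset_set// /uniform mulgK => ->; rewrite mul1r.
rewrite big_const_seq count_predT iter_addr_0 -[LHS]mulr_natr mulVf//.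
by rewrite pnatr_eq0 -lt0n.
Qed.

Definition uniform_kernel : markov_kernel R G G :=
  MarkovKernel uniform_ge0 uniform_fin uniform_sum.

(** The successor leaves room for a contraction factor [1 - eps] that is positive
    even if [N] is a singleton. *)
Lemma uniform_common v w : N (w * (f v)^-1)%g ->
  (card.+1%:R)^-1 <= uniform_kernel v w.
Proof.
move=> Nw; rewrite /= /uniform mem_set// mul1r lef_pV2 ?posrE ?ltr0n//.
by rewrite ler_nat.
Qed.

End Uniform.

(** Right translation by [g] of the point is absorbed by a change of summation
    variable, so equivariance is a property of the kernel alone. *)
Lemma kernel_map_act T (k : markov_kernel R G G)
    (kT : kernel_simplicial (rips T) (rips T) k) (g h : G) :
  (forall v w, k (v * g)%g w = k v (w * h^-1)%g) ->
  forall x, kernel_map kT (rips_act x g) = rips_act (kernel_map kT x) h.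
Proof.
move=> kgh x; have act (y : realization R (rips T)) (u w : G) :
    Defs.pushforward (fun v : G => v * u)%g y w = y (w * u^-1)%g.
  transitivity (\sum_(v \in [set (w * u^-1)%g]) y v); last exact: fsbig_set1.
  apply: eq_fsbigl.
  by apply/seteqP; split=> v /= => [<-|->]; rewrite ?mulgK ?mulgVK.
apply: realization_eq => w.
transitivity (kernel_map kT x (w * h^-1)%g); last exact/esym/act.
rewrite /= /kernel_push.
rewrite (@reindex_fsbigT _ _ _ _ _ (fun v => v * g)%g); last first.
  by exists (fun v => v * g^-1)%g => v; rewrite ?mulgK ?mulgVK.
by apply: eq_fsbigr => v _; rewrite kgh; congr (_ * _); rewrite [LHS]act mulgK.
Qed.

End RipsKernel.

Theorem theorem1p2 (R : realType) (G : groupType) (phi : virtual_endo G)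
    (d : nat) (r : 'I_d.+1 -> G) (S : set G)
    (r_transversal : coset_transversal phi r)
    (phi_surj : vsurjective phi)
    (phi_contr : contracting_endo phi r)
    (S_fin : finite_set S)
    (S_gen : generates S)
    (S_1 : S 1%g)
    (S_inv : [set s^-1%g | s in S] = S) :
  exists m n : nat, [/\ (0 < m)%N, (0 < n)%N &
    exists (Fn_simplicial : simplicial_map (rips (setpow S m)) (rips (setpow S m))
                              (iter n (transversal_map phi r)))
           (Psi : realization R (rips (setpow S m)) ->
                  realization R (rips (setpow S m))),
      contracting_map Psi /\
      homotopic_through R
        [set Phi | continuous Phi /\
           forall xi g, iter_dom phi n g ->
             Phi (rips_act xi g) = rips_act (Phi xi) (iter n phi g)]
        (realize R Fn_simplicial) Psi].
Proof.
have [N Nfin N_sections] := phi_contr.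
have [m' N_pow] : exists m', forall g, N g -> setpow S m' g.
  apply: finite_uniform Nfin _ _ => [a b g|g _]; first exact: setpow_le.
  exact: generates_setpow.
(* Three factors, since points of [N F^n(A)] differ by elements of [N N N^-1]. *)
pose m := (m'.+1 * 3)%N; pose T := setpow S m.
have Tfin : finite_set T by exact: setpow_fin.
have [n' n'_sections] : exists n', forall g, T g ->
    forall v, (n' <= size v)%N -> N (section_word phi r g v).
  apply: finite_uniform Tfin _ _ => [a b g ab gN v bv|g _].
    by apply: gN; exact: leq_trans bv.
  exact: N_sections.
pose n := n'.+1; pose f := iter n (transversal_map phi r).
have f_N A g h : rips T A -> A g -> A h -> N (f g * (f h)^-1)%g.
  move=> [_ AT] Ag Ah.
  have [v vn ->] := iter_transversal_map_div r_transversal n g h.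
  by apply: n'_sections; [apply: (AT h Ah); exists g|rewrite vn].
(* The displacement of [F^n] on a one-vertex simplex. *)
have N1 : N 1%g.
  have T1 : rips T [set 1%g].
    split=> [|_ -> _ [_ -> <-]]; first by exists 1%g.
    by rewrite mulgV; exact: setpow_one.
  by rewrite -(mulgV (f 1%g)); exact: (f_N _ _ _ T1).
have N_T a b c : N a -> N b -> N c -> T (a * b * c^-1)%g.
  have N_pow1 g : N g -> setpow S m'.+1 g.
    by move=> /N_pow; apply: setpow_le.
  move=> /N_pow1 Sa /N_pow1 Sb /N_pow1 Sc.
  rewrite /T /m -(addn1 2) mulnDr muln2 -addnn muln1.
  by do 2?apply: setpowM => //; exact: setpowV.
(* The set [N F^n(A)], a simplex containing every support that occurs below. *)
pose hull A := [set w | exists2 v, A v & N (w * (f v)^-1)%g].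
have hull_rips A : rips T A -> rips T (hull A).
  move=> TA; have [[a Aa] _] := TA; split.
    by exists (f a), a; rewrite ?mulgV.
  move=> g [u Au Ng] _ [h [v Av Nh] <-].
  have := N_T _ _ _ Nh (f_N A v u TA Av Au) Ng.
  by rewrite invgM invgK !mulgA !mulgVK.
pose k0 := dirac_kernel R f; pose k1 := uniform_kernel R f Nfin N1.
have k0_hull A : kernel_image k0 A `<=` hull A.
  move=> w [v Av] /=; have [->|_] := eqVneq w (f v); last by rewrite eqxx.
  by exists v; rewrite ?mulgV.
have k1_hull A : kernel_image k1 A `<=` hull A.
  by move=> w [v Av /uniform_supp Nw]; exists v.
have f_simplicial : simplicial_map (rips T) (rips T) f.
  move=> A TA; have [[a Aa] _] := TA; have [_ hT] := hull_rips _ TA.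
  have fA g : A g -> hull A (f g) by move=> Ag; exists g; rewrite ?mulgV.
  split=> [|_ [g Ag <-] _ [_ [h Ah <-] <-]]; first by exists (f a), a.
  by apply: (hT _ (fA g Ag)); exists (f h) => //; exact: fA.
have k0T : kernel_simplicial (rips T) (rips T) k0.
  by apply: rips_kernel_simplicial => A TA; exists (hull A); first exact: hull_rips.
have kT t : kernel_simplicial (rips T) (rips T) (interp_kernel k0 k1 t).
  apply: rips_kernel_simplicial => A TA; exists (hull A); first exact: hull_rips.
  by move=> w [v Av /interp_supp[kvw|kvw]]; [apply: k0_hull|apply: k1_hull];
    exists v.
have k1T : kernel_simplicial (rips T) (rips T) k1.
  by apply: rips_kernel_simplicial => A TA; exists (hull A); first exact: hull_rips.
have T_card := fun A => rips_card (A := A) Tfin.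
exists m, n; split=> //; exists f_simplicial, (kernel_map k1T); split.
  pose eps : R := (#|` fset_set N|.+1%:R)^-1.
  apply: (l1_contracting_map (theta := 1 - eps) T_card).
    have N_gt0 := card_fset_set_gt0 Nfin N1.
    rewrite subr_gt0 gtrBl invr_gt0 ltr0n andbT.
    by rewrite invf_lt1 ?ltr0n// ltr1n ltnS.
  move=> A x y TA Ax Ay; exists (kernel_image k1 A).
  split; [exact: k1T|exact: in_simplex_kernel_map|exact: in_simplex_kernel_map|].
  (* Any value of [F^n] on [A] is a common atom of the measures over [A]. *)
  have [[a Aa] _] := TA.
  apply: (kernel_map_l1_contract k1T (w0 := f a) Ax Ay) => v Av.
  by apply: uniform_common; exact: f_N TA Aa Av.
exists (fun t => kernel_map (kT t)); split.
- apply: continuous_subspaceT; apply: interp_map_continuous T_card _ => A TA.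
  by exists (hull A); split; [exact: hull_rips|exact: k0_hull|exact: k1_hull].
- by rewrite (interp_map0 kT k0T); exact: dirac_kernel_map.
- exact: interp_map1.
move=> t _; split.
  apply: lipschitz_continuous (kernel_map_lipschitz T_card (kT t)).
  by rewrite ltr0n.
move=> x g g_dom; apply: kernel_map_act => v w.
have fvg : f (v * g)%g = (f v * iter n phi g)%g by exact: iter_transversal_mapM.
rewrite /= /interp /= /uniform fvg invgM mulgA; congr (_ * (nat_of_bool _)%:R + _).
by apply/eqP/eqP => [->|<-]; rewrite ?mulgK ?mulgVK.
Qed.
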